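(* There exist absolute constants $c_1,c_2>0$ such that the following holds. Let $S\subset\mathbb{R}^N$ be a semi-algebraic set contained in $V(\mathbb{R})$, where $V\subset\mathbb{C}^N$ is a real algebraic set which is a union of non-singular real algebraic varieties. Then the height of any algebraic computation tree testing membership in $S$ is at least \[ \frac{1}{1+\log\deg V}\big(c_1\log b_0(S) - c_2\dim V\big). \]
   Context: An algebraic computation tree with input variables $X_1,\ldots,X_N$ is a rooted tree with: computation vertices (outdegree 1), each with a variable $Y_v$ and an instruction $Y_v = a * b$, $*\in\{+,-,\times\}$, where $a,b$ are real constants, input variables, or variables of predecessor vertices; branching vertices (outdegree 3, edges labelled $0,1,-1$), to which $Y_v$ is assigned a real constant, input variable, or predecessor variable, the edges corresponding to $Y_v=0$, $Y_v>0$, $Y_v<0$; and leaves labelled YES or NO. On input $x\in\mathbb{R}^N$ one evaluates along the path from the root, following branches according to signs; $x$ is accepted if the path ends in a YES leaf. The tree tests membership in $S$ if the set of accepted inputs is exactly $S$. The height is the length of the longest root-to-leaf path. $b_0(S)$ is the number of connected components of $S$. $\deg V$, $\dim V$ are the degree and dimension of $V$ as a complex algebraic set. *)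

(* Defs.v *)
From HB Require Import structures.
From mathcomp Require Import all_boot all_order all_algebra.
From mathcomp Require Import complex.
From mathcomp Require mpoly.
From mathcomp Require Import boolp classical_sets reals Rstruct Rstruct_topology.
From mathcomp Require Import topology normedtype exp.
Set Implicit Arguments.
Unset Strict Implicit.
Unset Printing Implicit Defensive.
Import Order.TTheory GRing.Theory Num.Theory.
Local Open Scope ring_scope.
Local Open Scope classical_set_scope.

Notation RR := Rdefinitions.R.
Notation CC := (complex Rdefinitions.R).

Notation RPt N := 'rV[RR]_N.
Notation CPt N := 'rV[CC]_N.
Notation RPoly N := (mpoly.mpoly N RR).
Notation CPoly N := (mpoly.mpoly N CC).

Definition rev_ (N : nat) (p : RPoly N) (x : RPt N) : RR :=
  mpoly.meval (fun i => x ord0 i) p.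
Definition cev_ (N : nat) (p : CPoly N) (x : CPt N) : CC :=
  mpoly.meval (fun i => x ord0 i) p.

Definition cplx_pt (N : nat) (x : RPt N) : CPt N :=
  \row_(i < N) (Complex (x ord0 i) 0).

Definition zero_set (N : nat) (P : set (CPoly N)) : set (CPt N) :=
  [set x | forall p, P p -> cev_ p x = 0].

Definition zclosed (N : nat) (A : set (CPt N)) : Prop :=
  exists P : set (CPoly N), A = zero_set P.

Definition real_alg_set (N : nat) (A : set (CPt N)) : Prop :=
  exists P : set (CPoly N),
    (forall p, P p -> forall m, Im (mpoly.mcoeff m p) = 0) /\ A = zero_set P.

Definition zirreducible (N : nat) (A : set (CPt N)) : Prop :=
  [/\ zclosed A, A <> set0 &
      forall B C : set (CPt N), zclosed B -> zclosed C ->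
        A = B `|` C -> A = B \/ A = C].

Definition zchain (N : nat) (A : set (CPt N)) (d : nat) : Prop :=
  exists f : nat -> set (CPt N),
    (forall i, (i <= d)%N -> zirreducible (f i) /\ f i `<=` A) /\
    (forall i, (i < d)%N -> f i `<=` f i.+1 /\ f i <> f i.+1).

Definition zdim (N : nat) (A : set (CPt N)) (d : nat) : Prop :=
  zchain A d /\ ~ zchain A d.+1.

Definition zcomponent (N : nat) (A Z : set (CPt N)) : Prop :=
  [/\ zirreducible Z, Z `<=` A &
      forall Z', zirreducible Z' -> Z `<=` Z' -> Z' `<=` A -> Z' = Z].

Definition ncard (T : eqType) (A : set T) (k : nat) : Prop :=
  exists s : seq T, [/\ uniq s, size s = k & A = [set x | x \in s]].

Definition aff_codim (N d : nat) (L : set (CPt N)) : Prop :=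
  exists (M : 'M[CC]_(N, d)) (b : 'rV[CC]_d),
    \rank M = d /\ L = [set x | x *m M = b].

Definition irr_deg (N : nat) (Z : set (CPt N)) (k : nat) : Prop :=
  exists d, [/\ zdim Z d,
    (exists L, aff_codim d L /\ ncard (Z `&` L) k) &
    (forall L k', aff_codim d L -> ncard (Z `&` L) k' -> (k' <= k)%N)].

Definition zdeg (N : nat) (A : set (CPt N)) (D : nat) : Prop :=
  exists n (f : 'I_n -> set (CPt N)) (g : 'I_n -> nat),
    [/\ injective f,
        (forall Z, zcomponent A Z <-> exists i, f i = Z),
        (forall i, irr_deg (f i) (g i)) &
        D = (\sum_(i < n) g i)%N].

Definition vanishing_ideal (N : nat) (A : set (CPt N)) : set (CPoly N) :=
  [set p | forall x, A x -> cev_ p x = 0].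

Definition jacobian (N k : nat) (fs : 'I_k -> CPoly N) (x : CPt N)
  : 'M[CC]_(k, N) :=
  \matrix_(i < k, j < N) cev_ (mpoly.mderiv j (fs i)) x.

Definition jac_rank (N : nat) (A : set (CPt N)) (x : CPt N) (r : nat)
  : Prop :=
  (exists k (fs : 'I_k -> CPoly N),
      (forall i, vanishing_ideal A (fs i)) /\ \rank (jacobian fs x) = r) /\
  (forall k (fs : 'I_k -> CPoly N),
      (forall i, vanishing_ideal A (fs i)) -> (\rank (jacobian fs x) <= r)%N).

Definition nonsingular_point (N : nat) (W : set (CPt N)) (x : CPt N)
  : Prop :=
  exists Z d, [/\ zcomponent W Z, Z x,
     (forall Z', zcomponent W Z' -> Z' x -> Z' = Z),
     zdim Z d & jac_rank W x (N - d)].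

Definition nonsingular_real_variety (N : nat) (W : set (CPt N)) : Prop :=
  real_alg_set W /\ forall x, W x -> nonsingular_point W x.

Definition semialgebraic (N : nat) (S : set (RPt N)) : Prop :=
  exists n m (P : 'I_n -> 'I_m -> RPoly N) (s : 'I_n -> 'I_m -> int),
    S = [set x | exists i, forall j, Num.sg (rev_ (P i j) x) = (s i j)%:~R].

Definition b0 (N : nat) (S : set (RPt N)) (n : nat) : Prop :=
  exists f : 'I_n -> set (RPt N),
    injective f /\
    forall C, (exists x, S x /\ C = connected_component S x) <->
              (exists i, f i = C).

(** Algebraic computation trees with inputs X_1..X_N.
    [OVar k] is the variable of the k-th computation vertex on the path
    from the root (numbered from 0). *)
Inductive operand (N : nat) : Type :=
  | OConst of RR
  | OInput of 'I_N
  | OVar of nat.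

Inductive arith_op : Type := AAdd | ASub | AMul.

Inductive act (N : nat) : Type :=
  | Leaf of bool
  | Comp of arith_op & operand N & operand N & act N
  | Branch of operand N & act N & act N & act N.   (* Y_v = a; edges 0, 1 (>0), -1 (<0) *)

Arguments OConst {N}.
Arguments OInput {N}.
Arguments OVar {N}.
Arguments Leaf {N}.

Definition operand_val (N : nat) (x : RPt N) (h : seq RR) (o : operand N)
  : RR :=
  match o with
  | OConst c => c
  | OInput i => x ord0 i
  | OVar k => nth 0 h k
  end.

Definition arith_val (op : arith_op) (a b : RR) : RR :=
  match op with AAdd => a + b | ASub => a - b | AMul => a * b end.

Fixpoint act_accepts (N : nat) (x : RPt N) (h : seq RR) (t : act N)
  : bool :=
  match t with
  | Leaf b => b
  | Comp op a b t' =>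
      act_accepts x (rcons h (arith_val op (operand_val x h a)
                                           (operand_val x h b))) t'
  | Branch a t0 tpos tneg =>
      let y := operand_val x h a in
      if y == 0 then act_accepts x h t0
      else if 0 < y then act_accepts x h tpos
      else act_accepts x h tneg
  end.

Definition operand_wf (N : nat) (k : nat) (o : operand N) : Prop :=
  match o with OVar j => (j < k)%N | _ => True end.

Fixpoint act_wf (N : nat) (k : nat) (t : act N) : Prop :=
  match t with
  | Leaf _ => True
  | Comp _ a b t' => [/\ operand_wf k a, operand_wf k b & act_wf k.+1 t']
  | Branch a t0 tp tn =>
      [/\ operand_wf k a, act_wf k t0, act_wf k tp & act_wf k tn]
  end.

Fixpoint act_height (N : nat) (t : act N) : nat :=
  match t with
  | Leaf _ => 0
  | Comp _ _ _ t' => (act_height t').+1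
  | Branch _ t0 tp tn =>
      (maxn (act_height t0) (maxn (act_height tp) (act_height tn))).+1
  end.

Definition act_tests (N : nat) (t : act N) (S : set (RPt N)) : Prop :=
  act_wf 0 t /\ forall x, act_accepts x [::] t <-> S x.

(* Main.v *)
(** The variety plays no role: a tree of height [h] only tests sets with at most
    [C ^ h] components. Follow a path of the tree and introduce one variable per
    vertex, equal to the computed value, resp. a [w] with [y * w ^ 2 = 1] or [-1]
    witnessing the sign of [y]. Each of the at most [3 ^ h] leaf sets becomes the
    projection of a real algebraic set cut out by at most [h] equations of degree at
    most 3 in at most [3 h] variables, all other inputs being free. Components of such
    a set are counted as in the Oleinik-Petrovskii-Milnor-Thom bound, but without
    transversality: a small perturbation [\sum p ^ 2 + e * \sum x_i ^ 8] has a local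
    minimum near each component, and its critical equations, of the form
    [x_i ^ 7 = lower degree], have at most [7 ^ n] solutions. *)
Require Import Defs.
From Stdlib Require List.
From HB Require Import structures.
From mathcomp Require Import all_boot all_order all_algebra.
From mathcomp Require Import complex.
From mathcomp Require mpoly.
From mathcomp Require Import boolp classical_sets reals Rstruct Rstruct_topology.
From mathcomp Require Import topology normedtype derive exp.
From mathcomp Require Import zify ring lra.
Set Implicit Arguments.
Unset Strict Implicit.
Unset Printing Implicit Defensive.
Import Order.TTheory GRing.Theory Num.Theory.
Import numFieldNormedType.Exports.
Local Open Scope ring_scope.
Local Open Scope classical_set_scope.

(** * Triangular systems of polynomial equations *)

(** Polynomials are syntax trees, so that a degree bound, the variables that occur and the partial
    derivatives are structural recursions. *)
Inductive pexp (R : Type) (n : nat) : Type :=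
  | PConst of R
  | PVar of 'I_n
  | PAdd of pexp R n & pexp R n
  | PMul of pexp R n & pexp R n.
Arguments PConst {R n}.
Arguments PVar {R n}.

Fixpoint pev (R : pzRingType) n (p : pexp R n) (x : 'rV[R]_n) : R :=
  match p with
  | PConst c => c
  | PVar i => x ord0 i
  | PAdd p q => pev p x + pev q x
  | PMul p q => pev p x * pev q x
  end.

(** Only an upper bound for the degree: cancellations are not seen. *)
Fixpoint pdeg (R : Type) n (p : pexp R n) : nat :=
  match p with
  | PConst _ => 0
  | PVar _ => 1
  | PAdd p q => maxn (pdeg p) (pdeg q)
  | PMul p q => pdeg p + pdeg q
  end.

Definition monomial (R : pzRingType) n (a : 'I_n -> nat) (x : 'rV[R]_n) : R :=
  \prod_i x ord0 i ^+ a i.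

Lemma pexp_monomials (R : comNzRingType) n (p : pexp R n) :
  exists s : seq (R * ('I_n -> nat)),
    (forall cb, List.In cb s -> \sum_i cb.2 i <= pdeg p)%N /\
    (forall x, pev p x = \sum_(cb <- s) cb.1 * monomial cb.2 x).
Proof.
elim: p => [c|i|p [s [sd sE]] q [t [td tE]]|p [s [sd sE]] q [t [td tE]]].
- exists [:: (c, fun=> 0%N)]; split=> [cb [<-|//]|x] /=; first by rewrite big1.
  by rewrite big_seq1 /monomial big1 ?mulr1.
- exists [:: (1, fun j => (j == i) : nat)]; split=> [cb [<-|//]|x] /=.
    by rewrite (bigD1 i) //= eqxx big1 // => j /negPf->.
  rewrite big_seq1 mul1r /monomial (bigD1 i) //= eqxx expr1 big1 ?mulr1 //.
  by move=> j /negPf->.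
- exists (s ++ t); split=> [cb|x] /=; last by rewrite big_cat sE tE.
  by move/List.in_app_iff=> [/sd|/td]; rewrite leq_max => ->; rewrite ?orbT.
- exists (flatten [seq [seq (cb.1 * cd.1, fun i => (cb.2 i + cd.2 i)%N) | cd <- t]
                  | cb <- s]); split=> [cb|x] /=.
    elim: s sd {sE} => [|ab s IH] sd //= /List.in_app_iff [|]; last first.
      by apply: IH => cd ?; apply: sd; right.
    move/List.in_map_iff => [cd [<- /td le2]] /=; rewrite big_split /=.
    by apply: leq_add => //; apply: sd; left.
  rewrite big_flatten big_map sE mulr_suml; apply: eq_bigr => cb _.
  rewrite big_map tE mulr_sumr; apply: eq_bigr => cd _ /=.
  rewrite mulrACA /monomial -big_split /=; congr (_ * _).
  by apply: eq_bigr => i _; rewrite exprD.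
Qed.

(** Lagrange interpolation: for each [k] in [s] take a coordinate [i] in which [q j] and [q k]
    differ, and multiply by [x_i - q k ord0 i] divided by its value at [q j]. *)
Lemma pexp_separation (F : fieldType) n (I : eqType) (q : I -> 'rV[F]_n)
    (j : I) (s : seq I) :
  injective q -> j \notin s ->
  exists p : pexp F n, pev p (q j) = 1 /\ forall k, k \in s -> pev p (q k) = 0.
Proof.
move=> qI; elim: s => [|k s IH]; first by exists (PConst 1).
rewrite inE negb_or => /andP[jk /IH[p [pj ps]]].
have [i qi] : exists i, q j ord0 i != q k ord0 i.
  apply: contrapT => /forallNP qE; case/eqP: jk; apply/qI/rowP=> i.
  by apply/eqP/negPn/negP/qE.
pose c := (q j ord0 i - q k ord0 i)^-1.
exists (PMul (PMul (PConst c) (PAdd (PVar i) (PConst (- q k ord0 i)))) p).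
split=> [|l] /=; first by rewrite pj mulr1 mulVf ?subr_eq0.
by rewrite inE => /predU1P[->|/ps->]; rewrite ?subrr ?mulr0 ?mul0r.
Qed.

(* The monomials with all exponents below [e] span every polynomial function on
   the points [q j], since [x_i ^+ e i] can be traded for lower degree terms. *)
Lemma triangular_bezout (F : fieldType) n M (q : 'I_M -> 'rV[F]_n)
    (e : 'I_n -> nat) (g : 'I_n -> pexp F n) :
  injective q -> (forall i, pdeg (g i) < e i)%N ->
  (forall i j, q j ord0 i ^+ e i = pev (g i) (q j)) ->
  (M <= \prod_i e i)%N.
Proof.
move=> qI ge qe.
(* A function is represented by its values at the [M] points. [U], spanned by at most [\prod_i e i]
   vectors of reduced monomials, turns out to be the whole space, of dimension [M]. *)
pose vec (f : 'rV[F]_n -> F) : 'rV[F]_M := \row_j f (q j).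
pose mon (a : {dffun forall i, 'I_(e i)}) := vec (monomial (fun i => a i : nat)).
pose U := <<[seq mon a | a : {dffun forall i, 'I_(e i)}]>>%VS.
(* [D] is a condition on total degrees: below [d] in the induction, always true for the final
   spanning claim. *)
have vec_sum s (D : nat -> Prop) :
    (forall b, D (\sum_i b i)%N -> vec (monomial b) \in U) ->
    (forall cb : F * ('I_n -> nat), List.In cb s -> D (\sum_i cb.2 i)%N) ->
    vec (fun x => \sum_(cb <- s) cb.1 * monomial cb.2 x) \in U.
  move=> DU; elim: s => [|cb s IH] sD.
    by rewrite (_ : vec _ = 0) ?mem0v //; apply/rowP=> j; rewrite !mxE big_nil.
  rewrite (_ : vec _ = cb.1 *: vec (monomial cb.2)
                       + vec (fun x => \sum_(cb <- s) cb.1 * monomial cb.2 x)).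
    apply: memvD; first by apply/memvZ/DU/sD; left.
    by apply: IH => cd ?; apply: sD; right.
  by apply/rowP=> j; rewrite !mxE big_cons.
have monU b : vec (monomial b) \in U.
  have [d] := ubnP (\sum_i b i); elim: d b => // d IH b; rewrite ltnS => bd.
  have [be|/existsNP[i /negP]] := pselect (forall i, b i < e i)%N.
    apply/memv_span/fintype.imageP; exists [ffun i => Ordinal (be i)] => //.
    by apply/rowP=> j; rewrite !mxE; apply: eq_bigr => i _; rewrite ffunE.
  rewrite -leqNgt => ebi.
  (* [b'] is the monomial [b] divided by [x_i ^+ e i]. Putting [g i] in place of that power gives
     terms of total degree below that of [b], to which the induction applies. *)
  pose b' k := if k == i then (b i - e i)%N else b k.
  have bE : (\sum_i b i = e i + \sum_i b' i)%N.
    rewrite (bigD1 i) //= [in RHS](bigD1 i) //= /b' eqxx addnA subnKC //.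
    by congr addn; apply: eq_bigr => k /negPf->.
  have [s [sd sE]] := pexp_monomials (g i).
  have := @vec_sum [seq (cb.1, fun k => (cb.2 k + b' k)%N) | cb <- s]
    (fun k => k < d)%N.
  rewrite (_ : vec (fun x => _) = vec (monomial b)); last first.
    apply/rowP=> j; rewrite !mxE big_map /=.
    rewrite (_ : monomial b (q j) = pev (g i) (q j) * monomial b' (q j)).
      rewrite sE mulr_suml; apply: eq_bigr => cb _; rewrite -mulrA; congr (_ * _).
      by rewrite /monomial -big_split; apply: eq_bigr => k _; rewrite exprD.
    rewrite -qe /monomial (bigD1 i) //= [in RHS](bigD1 i) //= /b' eqxx mulrA.
    rewrite -exprD subnKC //; congr (_ * _).
    by apply: eq_bigr => k /negPf->.
  apply=> // cb /List.in_map_iff[cd [<- /sd le]] /=; rewrite big_split /=.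
  apply: leq_trans bd; rewrite bE ltn_add2r; exact: leq_ltn_trans le (ge i).
have pevU p : vec (pev p) \in U.
  have [s [sd sE]] := pexp_monomials p.
  rewrite (_ : vec _ = vec (fun x => \sum_(cb <- s) cb.1 * monomial cb.2 x)).
    by apply: (@vec_sum s (fun=> True)).
  by apply/rowP=> j; rewrite !mxE sE.
have Ufull : (fullv <= U)%VS.
  apply/subvP=> v _; rewrite (row_sum_delta v); apply: memv_suml => j _.
  apply: memvZ.
  have [|p [pj p0]] := @pexp_separation _ _ _ q j [seq k <- enum 'I_M | k != j] qI.
    by rewrite mem_filter eqxx.
  rewrite (_ : delta_mx _ _ = vec (pev p)) //; apply/rowP=> k; rewrite !mxE eqxx /=.
  case: eqVneq => [->|kj]; first by rewrite pj.
  by rewrite p0 // mem_filter kj mem_enum.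
have := dimvS Ufull; rewrite dimvf /dim /= mul1n => /leq_trans; apply.
apply: leq_trans (dim_span _) _; rewrite size_map -cardE.
rewrite card_dep_ffun -[X in (_ <= X)%N]big_filter.
rewrite foldrE big_map enumT big_filter.
by under eq_bigr do rewrite card_ord.
Qed.

(** * Components of compact sets *)

(* Impredicative form of: finitely many steps shorter than [e], landing in [Z], lead
   from [x] to [y]. *)
Definition chained (R : realType) (T : pseudoMetricType R) (Z : set T) (e : R)
    (x y : T) : Prop :=
  forall B : set T, B x -> (forall a b, B a -> Z b -> ball a e b -> B b) -> B y.

Lemma chained_refl (R : realType) (T : pseudoMetricType R) (Z : set T) e x :
  chained Z e x x.
Proof. by []. Qed.

Lemma chained_trans (R : realType) (T : pseudoMetricType R) (Z : set T) e y x z :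
  chained Z e x y -> chained Z e y z -> chained Z e x z.
Proof. by move=> xy yz B Bx Bs; apply: yz => //; apply: xy. Qed.

Lemma chained_step (R : realType) (T : pseudoMetricType R) (Z : set T) e x y :
  Z y -> ball x e y -> chained Z e x y.
Proof. by move=> Zy xy B Bx Bs; apply: (Bs x). Qed.

Lemma chained_in (R : realType) (T : pseudoMetricType R) (Z : set T) e x y :
  Z x -> chained Z e x y -> Z y.
Proof. by move=> Zx xy; apply: (xy Z). Qed.

Lemma chained_sym (R : realType) (T : pseudoMetricType R) (Z : set T) e x y :
  Z x -> chained Z e x y -> chained Z e y x.
Proof.
move=> Zx xy; suff [] : Z y /\ chained Z e y x by [].
apply: (xy [set a | Z a /\ chained Z e a x]) => [|a b [Za ax] Zb ab]; first by split.
by split=> //; apply: chained_trans ax; apply: chained_step => //; exact: ball_sym.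
Qed.

Lemma chained_le (R : realType) (T : pseudoMetricType R) (Z : set T) e e' x y :
  e <= e' -> chained Z e x y -> chained Z e' x y.
Proof.
by move=> ee xy B Bx Bs; apply: xy => // a b Ba Zb /(le_ball ee); exact: Bs.
Qed.


(** Let [C] be the set of points chained to [x] for every [e]. If [C] split, the two parts would be
    compact, hence separated by some [d]. Points of [Z] outside the interiors of the
    [d / 3]-neighbourhoods of both parts are not in [C], so by compactness a single [e <= d / 3]
    keeps all [e]-chains from [x] away from them. Such chains cannot pass from one neighbourhood to
    the other, although they reach every point of [C]. *)
Lemma chained_connected (R : realType) (T : pseudoMetricType R) (Z : set T) x y :
  hausdorff_space T -> compact Z -> Z x -> (forall e, 0 < e -> chained Z e x y) ->
  exists C, [/\ connected C, C `<=` Z, C x & C y].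
Proof.
move=> hT cZ Zx xy.
have clZ := compact_closed hT cZ.
pose C := [set z | forall e, 0 < e -> chained Z e x z].
have CZ : C `<=` Z by move=> z /(_ 1 ltr01); exact: chained_in.
have clC : closed C.
  move=> z Cz; have Zz : Z z by apply: clZ; apply: closureS Cz.
  move=> e e0; have [w [Cw /ball_sym wz]] := Cz _ (nbhsx_ballx z _ e0).
  by apply: chained_trans (Cw _ e0) (chained_step Zz wz).
exists C; split=> //; last by move=> e _; exact: chained_refl.
apply: contrapT => /connectedPn[E [E0 CE [s1 s2]]].
have Ecl b : closed (E b).
  move=> z Ez; have := closureS _ Ez => /(_ C).
  have EC : E b `<=` C by rewrite CE; case: (b) => w Ew; [right|left].
  move=> /(_ EC) /clC; rewrite CE; case: b Ez EC => Ez EC [] // Ez'.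
    by have : set0 z by rewrite -s2.
  by have : set0 z by rewrite -s1.
have Ecp b : compact (E b).
  apply: (subclosed_compact (Ecl b) cZ); apply: subset_trans CZ.
  by rewrite CE; case: b => w Ew; [right|left].
(* [b0] names the part that contains [x]. *)
have [b0 [b0x Edisj]] : exists b, E b x /\ E b `&` E (~~ b) = set0.
  have : C x by move=> e _; exact: chained_refl.
  rewrite CE => -[] Ex; [exists false|exists true]; split=> //=.
    by rewrite -subset0 -s1 => w [? ?]; split=> //; exact: subset_closure.
  by rewrite -subset0 -s2 => w [? ?]; split=> //; exact: subset_closure.
pose A := E b0; pose B := E (~~ b0).
have CAB : C = A `|` B by rewrite CE /A /B; case: (b0); rewrite // setUC.
have [d d0 AB] : exists2 d : R, 0 < d & forall a b, A a -> B b -> ~ ball a d b.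
  have /compact_near_coveringP /(_ R (0^'+) (fun d a => forall b, B b -> ~ ball a d b)) := Ecp b0.
  have H : forall a, A a -> \forall a' \near a & d \near (0:R)^'+,
      forall b, B b -> ~ ball a' d b.
    move=> a Aa.
    have : nbhs a (~` B).
      apply: open_nbhs_nbhs; split; first exact/closed_openC/Ecl.
      by move=> Ba; have : set0 a by rewrite -Edisj.
    move=> /nbhs_ballP[r /= r0 rB].
    exists (ball a (r / 2), [set d | 0 < d < r / 2]) => /=.
      split; first by apply: nbhsx_ballx; rewrite divr_gt0.
      near=> d; apply/andP; split=> //; near: d.
      by apply: nbhs_right_lt; rewrite divr_gt0.
    move=> [a' d] /= [aa' /andP[d0 dr]] b Bb a'b; apply: (rB b) => //.
    by apply: ball_splitr (ball_sym aa') _ => //; apply: le_ball a'b; exact: ltW.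
  move=> /(_ _ H) nearAB.
  have : \forall d \near (0:R)^'+, 0 < d /\ (A `<=` (fun a => forall b, B b -> ~ ball a d b)).
    by near=> d; split => //; near: d.
  by move=> /filter_ex[d [d0 Ad]]; exists d => // a b /Ad; apply.
pose O (S : set T) := [set z | exists2 a, S a & ball a (d / 3) z].
have d3 : 0 < d / 3 by rewrite divr_gt0.
pose K := Z `\` ((O A)° `|` (O B)°).
have cK : compact K.
  apply: (subclosed_compact _ cZ); last by move=> z [].
  rewrite /K setDE; apply: closedI => //; apply: open_closedC.
  by apply: openU; exact: open_interior.
have [e [e0 ed eK]] : exists e, [/\ 0 < e, e <= d / 3 &
    forall z, K z -> ~ chained Z e x z].
  have /compact_near_coveringP /(_ R (0^'+) (fun e z => ~ chained Z e x z)) := cK.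
  have H : forall z, K z -> \forall z' \near z & e \near (0:R)^'+, ~ chained Z e x z'.
    move=> z [Zz zO].
    have [e e0 nz] : exists2 e, 0 < e & ~ chained Z e x z.
      apply: contrapT => nE; apply: zO.
      have : C z by move=> e e0; apply: contrapT => ?; apply: nE; exists e.
      by rewrite CAB => -[Sz|Sz]; [left|right]; apply/nbhs_ballP; exists (d / 3) => // w zw; exists z.
    exists (ball z e, [set e' | e' <= e]) => /=.
      by split; [exact: nbhsx_ballx | exact: nbhs_right_le].
    move=> [z' e'] /= [zz' ee] xz'; apply: nz.
    apply: chained_trans (chained_le ee xz') _.
    by apply: chained_step => //; exact: ball_sym.
  move=> /(_ _ H) nearK.
  have : \forall e \near (0:R)^'+, [/\ 0 < e, e <= d / 3 &
       K `<=` (fun z => ~ chained Z e x z)].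
    by near=> e; split => //; near: e; by [exact: nbhs_right_le | exact: nearK].
  by move=> /filter_ex[e [? ? Ke]]; exists e; split=> // z /Ke.
have [b Bb] := E0 (~~ b0).
(* Membership in [O A] is carried along the chain from [x] to [b]: a step from [O A] into [O B]
   would bring a point of [A] within [3 * (d / 3)] of a point of [B]. *)
have : (O A b).
  have : C b by rewrite CAB; right.
  move=> /(_ _ e0) /(_ [set z | chained Z e x z /\ O A z]) [||//].
    by split=> //; exists x => //; exact: ballxx.
  move=> u v [xu [a Aa au]] Zv uv.
  have xv : chained Z e x v by apply: chained_trans xu _; exact: chained_step.
  split=> //; apply: contrapT => Av.
  have [/eK//|] := pselect (K v).
  move=> /not_andP[//|/contrapT[/interior_subset//|/interior_subset[b' Bb' b'v]]].
  apply: (AB a b') => //.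
  have -> : d = d / 3 + d / 3 + d / 3 by lra.
  apply: ball_triangle (ball_sym b'v); apply: ball_triangle au _.
  by apply: le_ball uv.
move=> [a Aa ab]; apply: (AB a b) => //; apply: le_ball ab.
by lra.
Unshelve. all: by end_near. Qed.

(** Each of the finitely many pairs has a threshold by [chained_connected], and unchained points
    stay unchained for smaller [e]. *)
Lemma uniformly_unchained (R : realType) (T : pseudoMetricType R) (Z : set T)
    (I : finType) (A : {set I}) (z : I -> T) :
  hausdorff_space T -> compact Z -> (forall i, i \in A -> Z (z i)) ->
  (forall i j C, i \in A -> j \in A -> connected C -> C `<=` Z ->
     C (z i) -> C (z j) -> i = j) ->
  exists2 e, 0 < e &
    forall i j, i \in A -> j \in A -> chained Z e (z i) (z j) -> i = j.
Proof.
move=> hT cZ Zz zC.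
have H : forall ij : I * I, \forall e \near (0:R)^'+,
    ij.1 \in A -> ij.2 \in A -> chained Z e (z ij.1) (z ij.2) -> ij.1 = ij.2.
  move=> [i j] /=.
  have [iA|_] := boolP (i \in A); last by near=> e.
  have [jA|_] := boolP (j \in A); last by near=> e.
  have [[e e0 ne]|nE] := pselect (exists2 e, 0 < e & ~ chained Z e (z i) (z j)).
    by near=> e' => _ _ /(@chained_le _ _ _ _ e); case/(_ _)/ne; near: e'; exact: nbhs_right_le.
  have [|C [? ? ? ?]] := @chained_connected R T Z (z i) (z j) hT cZ (Zz _ iA).
    by move=> e e0; apply: contrapT => ?; apply: nE; exists e.
  by near=> e => _ _ _; apply: zC; eassumption.
have : \forall e \near (0:R)^'+, 0 < e /\ forall ij : I * I,
    ij.1 \in A -> ij.2 \in A -> chained Z e (z ij.1) (z ij.2) -> ij.1 = ij.2.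
  by near=> e; split=> //; near: e; apply: filter_forall.
by move=> /filter_ex[e [e0 He]]; exists e => // i j; apply: (He (i, j)).
Unshelve. all: by end_near. Qed.

(** Let [U i] be the [e / 2]-neighbourhood of the zeros of [P] chained to [z i], with [e] so small
    that distinct [z i] are unchained. The [U i] are disjoint and [P] is positive on their
    boundaries. For a small weight [d], the function [P + d * G] exceeds on the boundary its value
    [d * G (z i)] at [z i], so its minimum on the compact closure lies in [U i] and is local. *)
Lemma perturbed_minima (R : realType) n (I : finType) (A : {set I})
    (z : I -> 'rV[R]_n) (P G : 'rV[R]_n -> R) :
  continuous P -> continuous G -> (forall x, 0 <= P x) -> (forall x, 0 <= G x) ->
  compact [set x | P x = 0] -> (forall i, i \in A -> P (z i) = 0) ->
  (forall i j C, i \in A -> j \in A -> connected C -> C `<=` [set x | P x = 0] ->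
     C (z i) -> C (z j) -> i = j) ->
  exists e (q : I -> 'rV[R]_n), [/\ 0 < e, {in A &, injective q} &
    forall i, i \in A ->
      \forall x \near q i, P (q i) + e * G (q i) <= P x + e * G x].
Proof.
move=> cP cG P0 G0; set Z := [set x | _]; move=> cZ Zz zC.
have hT : hausdorff_space 'rV[R]_n by exact: norm_hausdorff.
have [e e0 chE] := uniformly_unchained hT cZ Zz zC.
have e2 : 0 < e / 2 by rewrite divr_gt0.
pose U i := [set x : 'rV[R]_n | exists a, [/\ Z a, chained Z e (z i) a & ball a (e / 2) x]].
have oU i : open (U i).
  rewrite openE => x [a [Za ca ax]]; have oa : open (ball a (e / 2)) by exact: ball_open.
  move: oa; rewrite openE => /(_ x ax) /nbhs_ballP[r r0 ar]; apply/nbhs_ballP; exists r => // y xy.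
  by exists a; split=> //; exact: ar.
have Uz i : i \in A -> U i (z i).
  by move=> iA; exists (z i); split; [exact: Zz|exact: chained_refl|exact: ballxx].
have Udisj i j x : i \in A -> j \in A -> U i x -> U j x -> i = j.
  move=> iA jA [a [Za ia ax]] [b [Zb jb bx]]; apply: chE => //.
  apply: chained_trans (chained_sym (Zz _ jA) jb).
  apply: chained_trans ia _; apply: chained_step => //.
  by apply: ball_split ax _; exact: ball_sym.
pose K i := closure (U i).
(* A zero of [P] in the closure of [U i] is one more step of the chain, hence in [U i]. *)
have KZ i x : i \in A -> K i x -> Z x -> U i x.
  move=> iA Kx Zx; have [w [[a [Za ia aw]] xw]] := Kx _ (nbhsx_ballx x _ e2).
  exists x; split=> //; last exact: ballxx.
  apply: chained_trans ia _; apply: chained_step => //.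
  by apply: ball_split aw _; exact: ball_sym.
have cK i : compact (K i).
  apply: bounded_closed_compact; last exact: closed_closure.
  have [M [_ ZM]] := compact_bounded cZ.
  exists (M + 1 + e); split=> [|M' MM' x Kx]; first exact: num_real.
  have [w [[a [Za ia aw]] xw]] := Kx _ (nbhsx_ballx x _ e2).
  have : ball a e x by apply: ball_split aw _; exact: ball_sym.
  rewrite -ball_normE /= => ax; rewrite -(subrK a x) (le_trans (ler_normD _ _)) //.
  apply: le_trans (ltW MM'); rewrite addrC lerD //; first by apply: ZM; rewrite ?ltrDl.
  by rewrite distrC ltW.
have Hd i : \forall d \near (0:R)^'+, i \in A ->
    forall x, K i x -> ~ U i x -> d * G (z i) < P x.
  have [iA|_] := boolP (i \in A); last by near=> d.
  have [[x0 Kx0]|K0] := pselect (K i `\` U i !=set0); last first.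
    by near=> d => _ x Kx Ux; exfalso; apply: K0; exists x.
  have [|||c] := @EVT_min_rV R n P (K i `\` U i).
  - by exists x0.
  - apply: (subclosed_compact _ (cK i)); last by move=> ? [].
    by rewrite setDE; apply: closedI; [exact: closed_closure|exact: open_closedC].
  - exact: continuous_subspaceT.
  rewrite inE => -[Kc Uc] cmin.
  have Pc : 0 < P c.
    by rewrite lt_def P0 andbT; apply/eqP => Pc; apply: Uc; exact: KZ.
  near=> d => _ x Kx Ux.
  apply: lt_le_trans (cmin x _); last by rewrite inE.
  (* The [+ 1] keeps the later divisor positive when [G (z i) = 0]. *)
  apply: (@le_lt_trans _ _ (d * (G (z i) + 1))).
    by rewrite ler_wpM2l // lerDl.
  rewrite -ltr_pdivlMr ?ltr_wpDl //.
  by near: d; apply: nbhs_right_lt; rewrite divr_gt0 // ltr_wpDl.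
have : \forall d \near (0:R)^'+, 0 < d /\ forall i, i \in A ->
    forall x, K i x -> ~ U i x -> d * G (z i) < P x.
  by near=> d; split=> //; near: d; apply: filter_forall.
move=> /filter_ex[d [d0 dG]].
have cF : continuous (fun x => P x + d * G x).
  by move=> x; exact: (cvgD (cP x) (cvgM (cvg_cst _) (cG x))).
have Hq i : exists q, i \in A -> U i q /\
    forall x, K i x -> P q + d * G q <= P x + d * G x.
  have [iA|_] := boolP (i \in A); last by exists 0.
  have Kz : K i (z i) by apply/subset_closure/Uz.
  have [|||q] := @EVT_min_rV R n (fun x => P x + d * G x) (K i).
  - by exists (z i).
  - exact: cK.
  - exact: continuous_subspaceT.
  rewrite inE => Kq qmin; exists q => _; split; last first.
    by move=> x Kx; apply: qmin; rewrite inE.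
  apply: contrapT => Uq; have := dG i iA q Kq Uq; apply/negP; rewrite -leNgt.
  have := qmin (z i); rewrite inE Zz // add0r => /(_ Kz); apply: le_trans.
  by rewrite lerDl mulr_ge0 // ltW.
have [q qP] := choice Hq.
exists d, q; split=> //.
  move=> i j iA jA qij; have [Ui _] := qP i iA; have [Uj _] := qP j jA.
  by apply: (Udisj _ _ (q i)) => //; rewrite qij.
move=> i iA; have [Ui qmin] := qP i iA.
have : nbhs (q i) (U i) by apply: open_nbhs_nbhs; split.
by apply: filterS => x Ux; apply: qmin; exact: subset_closure.
Unshelve. all: by end_near. Qed.

(** * Components of real algebraic sets *)

Fixpoint pvars (R : Type) n (p : pexp R n) : seq 'I_n :=
  match p with
  | PConst _ => [::]
  | PVar i => [:: i]
  | PAdd p q => pvars p ++ pvars q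
  | PMul p q => pvars p ++ pvars q
  end.

Fixpoint pder (R : pzRingType) n (i : 'I_n) (p : pexp R n) : pexp R n :=
  match p with
  | PConst _ => PConst 0
  | PVar k => PConst (k == i)%:R
  | PAdd p q => PAdd (pder i p) (pder i q)
  | PMul p q => PAdd (PMul (pder i p) q) (PMul p (pder i q))
  end.

Definition psum (R : pzRingType) n (s : seq (pexp R n)) : pexp R n :=
  foldr (@PAdd R n) (PConst 0) s.

Definition ppow (R : pzRingType) n (p : pexp R n) (k : nat) : pexp R n :=
  iter k (PMul p) (PConst 1).

Definition vanish (R : pzRingType) n (Q : seq (pexp R n)) (x : 'rV[R]_n) : bool :=
  all (fun p => pev p x == 0) Q.

Lemma pdeg_pder (R : pzRingType) n (i : 'I_n) (p : pexp R n) :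
  (pdeg (pder i p) <= pdeg p)%N.
Proof.
elim: p => //= p IHp q IHq; first by rewrite geq_max !leq_max IHp IHq orbT.
by rewrite geq_max leq_add2r IHp leq_add2l IHq.
Qed.

Lemma pev_eq_vars (R : pzRingType) n (p : pexp R n) (x y : 'rV_n) :
  {in pvars p, forall i, x ord0 i = y ord0 i} -> pev p x = pev p y.
Proof.
elim: p => //= [i|p IHp q IHq|p IHp q IHq] xy.
- by apply: xy; rewrite inE.
- by congr (_ + _); [apply: IHp|apply: IHq] => i ip;
    apply: xy; rewrite mem_cat ip ?orbT.
- by congr (_ * _); [apply: IHp|apply: IHq] => i ip;
    apply: xy; rewrite mem_cat ip ?orbT.
Qed.

Lemma vanish_eq_vars (R : pzRingType) n (Q : seq (pexp R n)) (J : {pred 'I_n})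
    (x y : 'rV_n) :
  all (fun p => all (mem J) (pvars p)) Q ->
  {in J, forall i, x ord0 i = y ord0 i} -> vanish Q x = vanish Q y.
Proof.
move=> QJ xy; elim: Q QJ => //= p Q IH /andP[pJ /IH ->]; congr (_ && _).
by rewrite (@pev_eq_vars _ _ p x y) // => i /(allP pJ); exact: xy.
Qed.

Lemma pev_pder_notin (R : pzRingType) n (i : 'I_n) (p : pexp R n) x :
  i \notin pvars p -> pev (pder i p) x = 0.
Proof.
elim: p => //= [k|p IHp q IHq|p IHp q IHq].
- by rewrite inE eq_sym => /negPf->.
- by rewrite mem_cat negb_or => /andP[/IHp-> /IHq->]; rewrite addr0.
- by rewrite mem_cat negb_or => /andP[/IHp-> /IHq->]; rewrite mul0r mulr0 addr0.
Qed.

Lemma pev_psum (R : pzRingType) n (s : seq (pexp R n)) x :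
  pev (psum s) x = \sum_(p <- s) pev p x.
Proof. by elim: s => [|p s IH] /=; rewrite ?big_nil // big_cons IH. Qed.

Lemma pev_pder_psum (R : pzRingType) n i (s : seq (pexp R n)) x :
  pev (pder i (psum s)) x = \sum_(p <- s) pev (pder i p) x.
Proof. by elim: s => [|p s IH] /=; rewrite ?big_nil // big_cons IH. Qed.

Lemma pdeg_psum (R : pzRingType) n (s : seq (pexp R n)) d :
  all (fun p => pdeg p <= d)%N s -> (pdeg (psum s) <= d)%N.
Proof. by elim: s => //= p s IH /andP[pd /IH sd]; rewrite geq_max pd. Qed.

Lemma pvars_psum (R : pzRingType) n (s : seq (pexp R n)) (J : {pred 'I_n}) :
  all (fun p => all (mem J) (pvars p)) s -> all (mem J) (pvars (psum s)).
Proof. by elim: s => //= p s IH /andP[pJ /IH sJ]; rewrite all_cat pJ. Qed.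

Lemma pev_ppow (R : pzRingType) n (p : pexp R n) k x :
  pev (ppow p k) x = pev p x ^+ k.
Proof. by elim: k => //= k ->; rewrite exprS. Qed.

Lemma pev_pder_ppow (R : comPzRingType) n i (p : pexp R n) k x :
  pev (pder i (ppow p k.+1)) x = k.+1%:R * pev p x ^+ k * pev (pder i p) x.
Proof.
elim: k => [|k IH]; first by rewrite /= mulr0 addr0 !mul1r mulr1.
have -> : pev (pder i (ppow p k.+2)) x = pev (pder i p) x * pev (ppow p k.+1) x
  + pev p x * pev (pder i (ppow p k.+1)) x by [].
by rewrite IH pev_ppow !exprS -[k.+2%:R]/(k.+1.+1%:R) [k.+2%:R]mulrSr; ring.
Qed.

(** First-order Taylor expansion along the [i]-th axis, with remainder [t ^+ 2] times a polynomial
    in [t]. *)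
Lemma pev_line (R : comNzRingType) n i (p : pexp R n) x :
  exists r : {poly R}, forall t, pev p (x + t *: delta_mx ord0 i) =
    pev p x + t * pev (pder i p) x + t ^+ 2 * r.[t].
Proof.
elim: p => [c|k|p [r rE] q [s sE]|p [r rE] q [s sE]] /=.
- by exists 0 => t; rewrite horner0; ring.
- by exists 0 => t; rewrite horner0 !mxE eqxx /=; ring.
- by exists (r + s) => t; rewrite rE sE hornerD; ring.
- exists (pev p x *: s + pev q x *: r + (pev (pder i p) x * pev (pder i q) x)%:P
    + 'X * (pev (pder i p) x *: s + pev (pder i q) x *: r) + 'X^2 * r * s) => t.
  by rewrite rE sE !hornerE; ring.
Qed.

Lemma pev_continuous (R : realType) n (p : pexp R n) : continuous (pev p).
Proof.
elim: p => [c|i|p IHp q IHq|p IHp q IHq] /= x.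
- exact: (@cst_continuous _ _ c).
- exact: (@coord_continuous _ _ _ ord0 i).
- exact: (cvgD (IHp x) (IHq x)).
- exact: (cvgM (IHp x) (IHq x)).
Qed.

Lemma pder_local_min (R : realType) n i (p : pexp R n) x :
  (\forall y \near x, pev p x <= pev p y) -> pev (pder i p) x = 0.
Proof.
move=> /nbhs_ballP[d /= d0 xmin].
have [r rE] := pev_line i p x; pose c := pev (pder i p) x.
(* [s] is the difference quotient: [t * s.[t]] is the increment of [p], nonnegative for small [t],
   and [s.[0]] is the derivative. Small [t] of either sign and continuity of [s] at 0 force it to
   vanish. *)
pose s := c%:P + 'X * r.
have tmin t : `|t| < d -> 0 <= t * s.[t].
  move=> td; have : pev p x <= pev p (x + t *: delta_mx ord0 i).
    apply: xmin; rewrite -ball_normE /= opprD addNKr normrN.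
    apply: le_lt_trans td; rewrite normrZ ler_piMr // [leLHS]/Num.norm /= mx_normrE.
    by apply/bigmax_leP; split=> // -[k l] _; rewrite !mxE normr_nat lern1 leq_b1.
  by rewrite rE !hornerE -addrA lerDl mulrDr expr2 -mulrA.
have s0 : s.[0] = c by rewrite !hornerE.
rewrite -/c -s0; have cs := @continuous_horner R s 0.
apply/eqP; rewrite eq_le; apply/andP; split; apply/ler_addgt0Pr => e e0.
- have /nbhs_ballP[d' /= d'0 ds] := cs _ (nbhsx_ballx s.[0] _ e0).
  pose t := - (Num.min d d' / 2).
  have m0 : 0 < Num.min d d' by rewrite lt_min d0 d'0.
  have t0 : t < 0 by rewrite oppr_lt0 divr_gt0.
  have tm : `|t| < Num.min d d' by rewrite normrN gtr0_norm ?divr_gt0 //; lra.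
  have := ds t; rewrite -ball_normE /= sub0r normrN => /(_ _).
  have := tmin t; move: tm; rewrite lt_min => /andP[-> ->] /(_ isT) + /(_ isT).
  rewrite nmulr_rge0 // => st /ltr_normlP [_]; lra.
- have /nbhs_ballP[d' /= d'0 ds] := cs _ (nbhsx_ballx s.[0] _ e0).
  pose t := (Num.min d d' / 2).
  have m0 : 0 < Num.min d d' by rewrite lt_min d0 d'0.
  have t0 : 0 < t by rewrite divr_gt0.
  have tm : `|t| < Num.min d d' by rewrite gtr0_norm ?divr_gt0 // /t; lra.
  have := ds t; rewrite -ball_normE /= sub0r normrN => /(_ _).
  have := tmin t; move: tm; rewrite lt_min => /andP[-> ->] /(_ isT) + /(_ isT).
  rewrite pmulr_rge0 // => st /ltr_normlP [+ _]; lra.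
Qed.

Lemma vanish_sum_sq (R : realDomainType) n (Q : seq (pexp R n)) (x : 'rV[R]_n) :
  vanish Q x = (\sum_(p <- Q) pev p x ^+ 2 == 0).
Proof.
elim: Q => [|p Q IH] /=; first by rewrite big_nil eqxx.
rewrite big_cons paddr_eq0 ?sqr_ge0 ?sumr_ge0 // => [|q _]; last exact: sqr_ge0.
by rewrite sqrf_eq0 -IH.
Qed.

Arguments psum : simpl never.
Arguments ppow : simpl never.

(* For small [e > 0], every component of the zero set of [\sum p ^ 2] carries its own
   local minimum of [\sum p ^ 2 + e * \sum x_i ^ 8]; at such a point
   [8 e x_i ^ 7] equals a polynomial of degree at most 6. *)
Lemma bounded_components (R : realType) n (Q : seq (pexp R n)) (J : {set 'I_n})
    (b : R) (I : finType) (A : {set I}) (z : I -> 'rV[R]_n) :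
  all (fun p => pdeg p <= 3)%N Q -> all (fun p => all (mem J) (pvars p)) Q ->
  let Z := [set x | vanish Q x /\ forall i, i \notin J -> x ord0 i = 0] in
  (forall x i, Z x -> `|x ord0 i| <= b) ->
  (forall i, i \in A -> Z (z i)) ->
  (forall i j C, i \in A -> j \in A -> connected C -> C `<=` Z ->
     C (z i) -> C (z j) -> i = j) ->
  (#|A| <= 7 ^ #|J|)%N.
Proof.
move=> Qdeg QJ Z Zb Zz zC.
pose P1 := psum [seq PMul p p | p <- Q].
(* [P2] is the sum of the squares of the variables outside [J]; adding it makes [Z] the zero set of
   [P]. *)
pose P2 := psum [seq if k \in J then PConst 0 else PMul (PVar k) (PVar k)
                | k <- enum 'I_n] : pexp R n.
pose P := PAdd P1 P2.
(* The eighth power is even, so [G] is nonnegative, and its derivative has degree 7, just above the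
   bound 6 for the derivatives of [P1]. *)
pose G := psum [seq if k \in J then ppow (PVar k) 8 else PConst 0
                | k <- enum 'I_n] : pexp R n.
have P1E x : pev P1 x = \sum_(p <- Q) pev p x ^+ 2.
  by rewrite pev_psum big_map; apply: eq_bigr => p _; rewrite expr2.
have P2E x : pev P2 x = \sum_(k | k \notin J) x ord0 k ^+ 2.
  rewrite pev_psum big_map big_enum /= [RHS]big_mkcond /=; apply: eq_bigr => k _.
  by case: ifP => //=; rewrite expr2.
have GE x : pev G x = \sum_(k in J) x ord0 k ^+ 8.
  rewrite pev_psum big_map big_enum /= [RHS]big_mkcond /=; apply: eq_bigr => k _.
  by case: ifP => // _; rewrite pev_ppow.
have P1ge x : 0 <= pev P1 x by rewrite P1E sumr_ge0 // => p _; exact: sqr_ge0.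
have P2ge x : 0 <= pev P2 x by rewrite P2E sumr_ge0 // => p _; exact: sqr_ge0.
have Pge x : 0 <= pev P x by rewrite addr_ge0.
have Gge x : 0 <= pev G x.
  by rewrite GE sumr_ge0 // => k _; rewrite (exprM _ 4 2) sqr_ge0.
have ZE : Z = [set x | pev P x = 0].
  apply/seteqP; split=> x /=.
    move=> [Qx xJ]; rewrite P1E P2E; move: Qx; rewrite vanish_sum_sq => /eqP->.
    by rewrite big1 ?addr0 // => k /xJ->; rewrite expr0n.
  move=> /eqP; rewrite paddr_eq0 // P1E -vanish_sum_sq P2E => /andP[Qx /eqP J0].
  split=> // i iJ; apply/eqP; rewrite -sqrf_eq0.
  by rewrite (psumr_eq0P _ J0) // => k _; exact: sqr_ge0.
have cZ : compact Z.
  apply: bounded_closed_compact.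
    exists `|b|; split; first exact: num_real.
    move=> M bM x Zx; rewrite /= [leLHS]/Num.norm /= mx_normrE.
    apply/bigmax_leP; split=> [|[k l] _ /=]; first exact: le_trans (normr_ge0 b) (ltW bM).
    by rewrite ord1 (le_trans (Zb x l Zx)) // (le_trans (ler_norm b)) // ltW.
  rewrite ZE (_ : [set x | _] = pev P @^-1` [set 0]) //.
  apply: closed_comp; last exact: closed_eq.
  by move=> x _; exact: pev_continuous.
have cP := @pev_continuous R n P; have cG := @pev_continuous R n G.
rewrite ZE in cZ Zz zC.
have [e [q [e0 qI qmin]]] :=
  @perturbed_minima R n I A z (pev P) (pev G) cP cG Pge Gge cZ Zz zC.
have crit j k : j \in A -> pev (pder k (PAdd P (PMul (PConst e) G))) (q j) = 0.
  by move=> jA; apply: pder_local_min; exact: qmin.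
have P2der k x : pev (pder k P2) x = if k \in J then 0 else 2 * x ord0 k.
  rewrite pev_pder_psum big_map big_enum /= (bigD1 k) //= big1 => [|l /negPf lk].
    by case: ifP => kJ /=; rewrite ?eqxx addr0 //=; ring.
  by case: ifP => //= _; rewrite lk mul0r mulr0 addr0.
have Gder k x : pev (pder k G) x = if k \in J then 8 * x ord0 k ^+ 7 else 0.
  rewrite pev_pder_psum big_map big_enum /= (bigD1 k) //= big1 => [|l /negPf lk].
    case: ifP => kJ; last by rewrite addr0.
    by rewrite addr0 pev_pder_ppow /= eqxx mulr1.
  by case: ifP => // _; rewrite pev_pder_ppow /= lk mulr0.
have P1J k : k \notin J -> forall x, pev (pder k P1) x = 0.
  move=> kJ x; apply: pev_pder_notin; apply: contra kJ; move: k.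
  apply/allP/pvars_psum; rewrite all_map; apply: sub_all QJ => p pJ /=.
  by rewrite all_cat pJ.
(* Criticality expresses [8 * e * x_k ^+ 7] as minus the [k]-th derivative of [P1] for [k] in [J],
   and reads [2 * x_k = 0] elsewhere. The exponents 7 and 1 have product [7 ^ #|J|]. *)
pose E k := if k \in J then 7%N else 1%N.
pose g k : pexp R n := if k \in J then PMul (PConst (- (8 * e)^-1)) (pder k P1) else PConst 0.
have := @triangular_bezout R n #|A| (fun j => q (enum_val j)) E g.
rewrite (_ : (\prod_i E i)%N = (7 ^ #|J|)%N); last first.
  by rewrite /E -big_mkcond /= prod_nat_const.
apply.
- by move=> i j /qI qij; apply: enum_val_inj; apply: qij; exact: enum_valP.
- move=> k; rewrite /g /E; case: ifP => // _ /=.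
  rewrite add0n ltnS; apply: leq_trans (pdeg_pder _ _) _; apply: pdeg_psum.
  by rewrite all_map; apply: sub_all Qdeg => p /= p3; exact: (leq_add p3 p3).
- move=> k j; have := crit (enum_val j) k (enum_valP j).
  have -> : pev (pder k (PAdd P (PMul (PConst e) G))) (q (enum_val j)) =
    pev (pder k P1) (q (enum_val j)) + pev (pder k P2) (q (enum_val j)) +
     (0 * pev G (q (enum_val j)) + e * pev (pder k G) (q (enum_val j))) by [].
  rewrite P2der Gder /E /g; case: ifPn => [kJ|kJ] /=; last first.
    rewrite P1J //; lra.
  have e8 : 8 * e != 0 by rewrite mulf_neq0 ?gt_eqF.
  move=> H; apply: (mulfI e8); rewrite [RHS]mulrA mulrN divff // mulN1r; move: H; lra.
Qed.

Lemma segment_in_connected (R : realType) n (x y : 'rV[R]_n) :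
  exists C, [/\ connected C, C x, C y &
    forall w, C w -> exists t, w = x + t *: (y - x)].
Proof.
exists ((fun t : R => x + t *: (y - x)) @` `[0, 1]); split.
- apply: connected_continuous_connected; first exact: segment_connected.
  apply: continuous_subspaceT => t.
  by apply: cvgD; [exact: cvg_cst|apply: cvgZr_tmp; exact: cvg_id].
- by exists 0; rewrite /= ?in_itv /= ?lexx ?ler01 // scale0r addr0.
- by exists 1; rewrite /= ?in_itv /= ?lexx ?ler01 // scale1r addrC subrK.
- by move=> w [t _ <-]; exists t.
Qed.

(* The variables outside [J] are free; they are set to [0], and [u] becomes the slack
   variable of a ball containing all the points, which makes the set compact. *)
Lemma components_bound (R : realType) n (Q : seq (pexp R n)) (J : {set 'I_n}) u
    (I : finType) (A : {set I}) (z : I -> 'rV[R]_n) :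
  all (fun p => pdeg p <= 3)%N Q -> all (fun p => all (mem J) (pvars p)) Q ->
  u \notin J -> (forall i, i \in A -> vanish Q (z i)) ->
  (forall i j C, i \in A -> j \in A -> connected C -> C `<=` vanish Q ->
     C (z i) -> C (z j) -> i = j) ->
  (#|A| <= 7 ^ #|J|.+1)%N.
Proof.
move=> Qdeg QJ uJ Qz zC.
(* [r] sums the squared [J]-norms of all the points, so each slack [s i] is nonnegative. *)
pose r := \sum_i \sum_(k in J) z i ord0 k ^+ 2.
pose s i := r - \sum_(k in J) z i ord0 k ^+ 2.
have s_ge0 i : 0 <= s i.
  rewrite /s /r (bigD1 i) //= addrAC subrr add0r sumr_ge0 // => j _.
  by rewrite sumr_ge0 // => k _; exact: sqr_ge0.
pose J' := (u |: J)%SET.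
(* The root of the slack at [u] puts [z' i] on the sphere where the squares of the coordinates in
   [J'] sum to [r]. *)
pose z' i : 'rV[R]_n := \row_k if k \in J then z i ord0 k
                      else if k == u then Num.sqrt (s i) else 0.
pose sphere := PAdd (psum [seq PMul (PVar k) (PVar k) | k <- enum J']) (PConst (- r)).
have sphereE x : pev sphere x = x ord0 u ^+ 2 + \sum_(k in J) x ord0 k ^+ 2 - r.
  rewrite /= pev_psum big_map big_enum /= (big_setU1 _ uJ) /= expr2.
  by congr (_ + _ - _); apply: eq_bigr => k _; rewrite expr2.
have zz' i : vanish Q (z' i) = vanish Q (z i).
  by apply: (vanish_eq_vars QJ) => k kJ; rewrite mxE kJ.
rewrite (_ : #|J|.+1 = #|J'|); last by rewrite cardsU1 uJ.
(* On the sphere [x_i ^+ 2 <= r], which gives [|x_i| <= r + 1] without taking a root. *)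
apply: (@bounded_components R n (sphere :: Q) J' (r + 1) I A z').
- rewrite [all _ _]/= Qdeg andbT geq_max /= andbT; apply: pdeg_psum.
  by rewrite all_map; apply/allP => k.
- rewrite [all _ _]/= cats0 pvars_psum /=.
    apply: sub_all QJ => p; apply: sub_all => k /= kJ.
    by rewrite !inE kJ orbT.
  by rewrite all_map; apply/allP => k; rewrite mem_enum /= => ->.
- move=> x i [/= /andP[/eqP + _] xJ]; rewrite [_ + _]sphereE => xr.
  have xi : x ord0 i ^+ 2 <= r.
    have [|/xJ->] := boolP (i \in J'); last first.
      by rewrite expr0n sumr_ge0 // => j _; rewrite sumr_ge0 // => k _; exact: sqr_ge0.
    rewrite !inE => /predU1P[->|iJ].
      have : 0 <= \sum_(k in J) x ord0 k ^+ 2 by rewrite sumr_ge0 // => k _; exact: sqr_ge0.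
      by move: xr; lra.
    have : x ord0 i ^+ 2 <= \sum_(k in J) x ord0 k ^+ 2.
      by rewrite (bigD1 i) //= lerDl sumr_ge0 // => k _; exact: sqr_ge0.
    by have := sqr_ge0 (x ord0 u); move: xr; lra.
  by rewrite ler_norml; apply/andP; split; nra.
- move=> i iA; split=> [|k].
    rewrite [vanish _ _]/= zz' Qz // andbT -[_ + _]/(pev sphere (z' i)) sphereE.
    rewrite mxE (negPf uJ) eqxx sqr_sqrtr // (eq_bigr (fun k => z i ord0 k ^+ 2)).
      by rewrite /s subrK subrr.
    by move=> k kJ; rewrite mxE kJ.
  by rewrite !inE negb_or mxE => /andP[/negPf-> /negPf->].
move=> i j C iA jA cC CZ Ci Cj.
(* [z' k] and [z k] agree on [J], so the segment between them stays in the zero set of [Q].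
   Attaching two such segments to [C] joins [z i] to [z j]. *)
have seg k : k \in A -> exists D, [/\ connected D, D (z' k), D (z k) & D `<=` vanish Q].
  move=> kA; have [D [cD D1 D2 Dt]] := segment_in_connected (z' k) (z k).
  exists D; split=> // w /Dt[t ->].
  rewrite /= (vanish_eq_vars QJ (y := z k)) ?Qz // => l lJ.
  by rewrite !mxE lJ subrr mulr0 addr0.
have [Di [cDi Di' Diz DiQ]] := seg i iA.
have [Dj [cDj Dj' Djz DjQ]] := seg j jA.
apply: (zC i j (Di `|` C `|` Dj)) => //.
- apply: connectedU => //; first by exists (z' j); split=> //; right.
  by apply: connectedU => //; exists (z' i).
- move=> w [[/DiQ|/CZ[/= /andP[]]]|/DjQ] //.
- by left; left.
- by right.
Qed.

(** * Computation trees *)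

(** The first [N] coordinates are the inputs, the other [K] are reserved for vertices. [h] holds
    expressions for the values computed so far; the default [PConst 0] matches the default 0 in
    [operand_val]. *)
Definition operand_exp N K (h : seq (pexp RR (N + K))) (o : operand N) :
    pexp RR (N + K) :=
  match o with
  | OConst c => PConst c
  | OInput i => PVar (lshift K i)
  | OVar k => nth (PConst 0) h k
  end.

Definition arith_exp N (op : arith_op) (a b : pexp RR N) : pexp RR N :=
  match op with
  | AAdd => PAdd a b
  | ASub => PAdd a (PMul (PConst (-1)) b)
  | AMul => PMul a b
  end.

Lemma pev_operand_exp N K h (o : operand N) (x : 'rV[RR]_(N + K)) :
  pev (operand_exp h o) x = operand_val (lsubmx x) [seq pev p x | p <- h] o.
Proof.
case: o => [c|i|k] //=; first by rewrite mxE.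
have [kh|kh] := ltnP k (size h); first by rewrite (nth_map (PConst 0)).
by rewrite !nth_default ?size_map.
Qed.

Lemma pev_arith_exp N op (a b : pexp RR N) x :
  pev (arith_exp op a b) x = arith_val op (pev a x) (pev b x).
Proof. by case: op => //=; rewrite mulN1r. Qed.

(** [d] bounds both the degree and the number of variable occurrences; all variables have index
    below [c], so that coordinates from [c] on are fresh. *)
Definition small_pexp n c d (p : pexp RR n) : bool :=
  [&& pdeg p <= d, size (pvars p) <= d & all (fun k : 'I_n => k < c) (pvars p)]%N.

Lemma small_pexp_leq n c c' d d' (p : pexp RR n) :
  (c <= c')%N -> (d <= d')%N -> small_pexp c d p -> small_pexp c' d' p.
Proof.
move=> cc dd /and3P[p1 p2 p3]; apply/and3P; split.
- exact: leq_trans dd.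
- exact: leq_trans dd.
- by apply: sub_all p3 => k /leq_trans; apply.
Qed.

Lemma small_pexp_eq n c d (p : pexp RR n) (x y : 'rV[RR]_n) :
  small_pexp c d p -> (forall k : 'I_n, (k < c)%N -> x ord0 k = y ord0 k) ->
  pev p x = pev p y.
Proof. by move=> /and3P[_ _ /allP pc] xy; apply: pev_eq_vars => k /pc; exact: xy. Qed.

Lemma small_operand_exp N K c (h : seq (pexp RR (N + K))) (o : operand N) :
  (N <= c)%N -> all (small_pexp c 1) h -> small_pexp c 1 (operand_exp h o).
Proof.
move=> Nc hc; case: o => [r|i|k] //=.
  by rewrite /small_pexp /= andbT (leq_trans (ltn_ord i)).
have [kh|kh] := ltnP k (size h); last by rewrite nth_default.
by move/(all_nthP (PConst 0)): hc; apply.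
Qed.

Definition set_coord n (v : 'I_n) (r : RR) (x : 'rV[RR]_n) : 'rV[RR]_n :=
  \row_k if k == v then r else x ord0 k.

Lemma set_coordE n (v : 'I_n) r x : set_coord v r x ord0 v = r.
Proof. by rewrite mxE eqxx. Qed.

Lemma pev_set_coord n (v : 'I_n) r x c d p :
  (c <= v)%N -> small_pexp c d p -> pev p (set_coord v r x) = pev p x.
Proof.
move=> cv /small_pexp_eq; apply=> k kc; rewrite mxE ifN //.
by apply: contraTneq kc => ->; rewrite -leqNgt.
Qed.

Lemma map_pev_set_coord n (v : 'I_n) r x c d h :
  (c <= v)%N -> all (small_pexp c d) h ->
  [seq pev p (set_coord v r x) | p <- h] = [seq pev p x | p <- h].
Proof. by move=> cv; elim: h => //= p h IH /andP[/(pev_set_coord _ _ cv)-> /IH->]. Qed.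

Lemma vanish_set_coord n (v : 'I_n) r x c d Q :
  (c <= v)%N -> all (small_pexp c d) Q ->
  vanish Q (set_coord v r x) = vanish Q x.
Proof. by move=> cv; elim: Q => //= p Q IH /andP[/(pev_set_coord _ _ cv)-> /IH->]. Qed.

Lemma lsubmx_set_coord N K (v : 'I_(N + K)) r x :
  (N <= v)%N -> lsubmx (set_coord v r x) = lsubmx x.
Proof.
move=> Nv; apply/rowP=> k; rewrite !mxE ifN //.
by apply: contraTneq Nv => <-; rewrite -ltnNge /=.
Qed.

Lemma lsubmx_continuous N K : continuous (@lsubmx RR 1 N K).
Proof.
move=> x A /nbhs_ballP[e /= e0 xA]; apply/nbhs_ballP; exists e => // y xy.
by apply: xA; split=> // i j; rewrite !mxE; exact: xy.2.
Qed.

(** Take for [J] the variables occurring in [Q], at most three per equation. The fresh coordinate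
    [N + c] serves as the slack variable. *)
Lemma small_leaf_bound N K c (Q : seq (pexp RR (N + K))) (I : finType)
    (A : {set I}) (z : I -> 'rV[RR]_(N + K)) :
  (c < K)%N -> all (small_pexp (N + c) 3) Q ->
  (forall i, i \in A -> vanish Q (z i)) ->
  (forall i j C, i \in A -> j \in A -> connected C -> C `<=` vanish Q ->
     C (z i) -> C (z j) -> i = j) ->
  (#|A| <= 7 ^ (3 * size Q).+1)%N.
Proof.
move=> cK Qc zQ zC.
have vK : (N + c < N + K)%N by lia.
pose s := flatten [seq pvars p | p <- Q].
pose J := [set k in s]%SET.
have Js : (#|J| <= 3 * size Q)%N.
  apply: (@leq_trans (size s)); first by rewrite cardsE card_size.
  rewrite /s size_flatten /shape -map_comp; elim: (Q) Qc => //= p Q' IH.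
  by move=> /andP[/and3P[_ p3 _] /IH]; lia.
have sA P : all P s = all (fun p => all P (pvars p)) Q.
  by rewrite /s; elim: (Q) => //= p Q' IH; rewrite all_cat IH.
have vJ : Ordinal vK \notin J.
  rewrite inE; have : all (fun k : 'I_(N + K) => k < N + c)%N s.
    by rewrite sA; apply: sub_all Qc => p /and3P[].
  by move=> /allP sc; apply/negP => /sc; rewrite ltnn.
apply: (@leq_trans (7 ^ #|J|.+1)); last by rewrite leq_exp2l.
apply: (components_bound (J := J) _ _ vJ zQ zC).
  by apply: sub_all Qc => p /and3P[].
by rewrite -sA; apply/allP => k ks; rewrite -[mem J k]/(k \in J) inE.
Qed.

(** Induction on the subtree below a path: [c] extra coordinates are in use, [h] gives the computed
    values, [Q] the equations recorded, [A] the inputs that follow the path and [z i] the lift of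
    [x i] to a solution of [Q]. Each vertex adds one equation, each branching a factor 3. *)
Lemma act_components_bound N K (S : set (RPt N)) (I : finType) (x : I -> RPt N)
    (t : act N) :
  forall c (h Q : seq (pexp RR (N + K))) (A : {set I}) (z : I -> 'rV[RR]_(N + K)),
  (c + act_height t < K)%N ->
  all (small_pexp (N + c) 1) h -> all (small_pexp (N + c) 3) Q ->
  (forall i, i \in A -> [/\ vanish Q (z i), lsubmx (z i) = x i &
     act_accepts (lsubmx (z i)) [seq pev p (z i) | p <- h] t]) ->
  (forall y, vanish Q y -> act_accepts (lsubmx y) [seq pev p y | p <- h] t ->
     S (lsubmx y)) ->
  (forall i j C, i \in A -> j \in A -> connected C -> C `<=` S ->
     C (x i) -> C (x j) -> i = j) ->
  (#|A| <= 3 ^ act_height t * 7 ^ (3 * (size Q + act_height t)).+1)%N.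
Proof.
elim: t => [b|op a1 a2 t IH|a t0 IH0 tp IHp tn IHn] c h Q A z cK hc Qc zA yS xC.
- rewrite mul1n addn0; rewrite /= addn0 in cK.
  have [b1|] := boolP b; last first.
    move=> b0; rewrite (_ : A = finset.set0) ?cards0 //; apply/setP=> i; rewrite inE.
    by apply/negP=> /zA[_ _ /= b1]; rewrite b1 in b0.
  apply: (small_leaf_bound cK Qc (z := z)) => [i /zA[]//|i j C iA jA cC CQ Ci Cj].
  (* At a YES leaf all solutions of [Q] project into [S], so a connected set of solutions projects
     to a connected subset of [S]. *)
  apply: (xC i j (lsubmx @` C)) => //.
  + by apply: connected_continuous_connected cC _; apply: continuous_subspaceT; exact: lsubmx_continuous.
  + by move=> _ [y /CQ Qy <-]; apply: yS.
  + by exists (z i) => //; have [] := zA i iA.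
  + by exists (z j) => //; have [] := zA j jA.
- rewrite /= in cK zA yS.
  have vK : (N + c < N + K)%N by lia.
  pose v := Ordinal vK.
  pose e := arith_exp op (operand_exp h a1) (operand_exp h a2).
  (* The fresh coordinate [v] is made equal to the computed value [e], so that the entries of [h]
     keep degree 1. [f] has at most three variable occurrences. *)
  pose f := PAdd (PVar v) (PMul (PConst (-1)) e).
  have sa o : small_pexp (N + c) 1 (operand_exp h o).
    by apply: small_operand_exp => //; exact: leq_addr.
  have se : small_pexp (N + c) 2 e.
    have := sa a1; have := sa a2; rewrite /e /small_pexp.
    by case: (op) => /= /and3P[d1 s1 c1] /and3P[d2 s2 c2];
      rewrite size_cat all_cat c1 c2 andbT; lia.
  have sf : small_pexp (N + c.+1) 3 f.
    move: se => /and3P[d1 s1 /allP c1]; rewrite /small_pexp /= addnS ltnSn /=.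
    apply/and3P; split; [lia|lia|].
    by apply/allP => k /c1; lia.
  have hE y : [seq pev p y | p <- rcons h (PVar v)] =
      rcons [seq pev p y | p <- h] (y ord0 v) by rewrite map_rcons.
  have eE y : pev e y = arith_val op
      (operand_val (lsubmx y) [seq pev p y | p <- h] a1)
      (operand_val (lsubmx y) [seq pev p y | p <- h] a2).
    by rewrite pev_arith_exp !pev_operand_exp.
  apply: (@leq_trans (3 ^ act_height t * 7 ^ (3 * (size (f :: Q) + act_height t)).+1)).
    apply: (IH c.+1 (rcons h (PVar v)) (f :: Q) A (fun i => set_coord v (pev e (z i)) (z i)));
      [lia| | | | |exact: xC].
    + rewrite all_rcons /small_pexp /= addnS ltnSn /=.
      by apply: sub_all hc => p; apply: small_pexp_leq; lia.
    + by rewrite /= sf /=; apply: sub_all Qc => p; apply: small_pexp_leq; lia.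
    + move=> i /zA[Qi xi ti]; rewrite hE set_coordE lsubmx_set_coord ?leq_addr //.
      rewrite (map_pev_set_coord _ _ _ hc) //= [in X in act_accepts _ X]eE.
      split=> //; rewrite set_coordE -/(vanish _ _) (pev_set_coord _ _ _ se) //.
      by rewrite mulN1r subrr eqxx (vanish_set_coord _ _ _ Qc).
    + move=> y /= /andP[/eqP ye Qy]; rewrite hE => yt; apply: yS => //.
      by rewrite -eE (_ : pev e y = y ord0 v) //; move: ye; lra.
  by rewrite [size _]/= [act_height (Comp _ _ _ _)]/= addSnnS leq_mul // leq_exp2l.
- rewrite /= in cK zA yS *.
  have vK : (N + c < N + K)%N by lia.
  pose v := Ordinal vK.
  pose e := operand_exp h a.
  have se : small_pexp (N + c) 1 e.
    by apply: small_operand_exp => //; exact: leq_addr.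
  (* The equation [e * v ^+ 2 + r = 0] has a solution [v] exactly when [e > 0] for [r = -1], and
     exactly when [e < 0] for [r = 1]. *)
  pose w (r : RR) := PAdd (PMul e (PMul (PVar v) (PVar v))) (PConst r).
  have sw r : small_pexp (N + c.+1) 3 (w r).
    move: se => /and3P[d1 s1 /allP c1]; rewrite /small_pexp /=.
    apply/and3P; split; [lia|rewrite !size_cat /=; lia|].
    rewrite cats0 all_cat /= addnS ltnSn /= andbT.
    by apply/allP => k /c1; lia.
  pose A0 := [set i in A | pev e (z i) == 0]%SET.
  pose Ap := [set i in A | 0 < pev e (z i)]%SET.
  pose An := [set i in A | pev e (z i) < 0]%SET.
  have AE : (#|A| <= #|A0| + (#|Ap| + #|An|))%N.
    apply: (@leq_trans #|A0 :|: (Ap :|: An)|).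
      apply/subset_leq_card/fintype.subsetP=> i iA; rewrite !inE iA /=.
      by case: ltgtP.
    apply: leq_trans (leq_card_setU _ _) _; rewrite leq_add2l.
    exact: leq_card_setU.
  pose H := maxn (act_height t0) (maxn (act_height tp) (act_height tn)).
  (* [B] bounds the count in each of the three subtrees; their sum gives the factor that turns
     [3 ^ H] into [3 ^ H.+1]. *)
  pose B := (3 ^ H * 7 ^ (3 * (size Q + H.+1)).+1)%N.
  suff : (#|A0| <= B /\ #|Ap| <= B /\ #|An| <= B)%N.
    move=> [b0 [bp bn]]; apply: leq_trans AE _.
    by rewrite expnS -mulnA -/H -/B; lia.
  have Bge k k' : (k <= H)%N -> (k' <= (size Q + H).+1)%N ->
      (3 ^ k * 7 ^ (3 * k').+1 <= B)%N.
    by move=> kH k'H; apply: leq_mul; rewrite leq_exp2l //; lia.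
  have Qc' r : all (small_pexp (N + c.+1) 3) (w r :: Q).
    by rewrite /= sw /=; apply: sub_all Qc => p; apply: small_pexp_leq; lia.
  have hc' : all (small_pexp (N + c.+1) 1) h.
    by apply: sub_all hc => p; apply: small_pexp_leq; lia.
  have eE y : operand_val (lsubmx y) [seq pev p y | p <- h] a = pev e y.
    by rewrite pev_operand_exp.
  split; [|split].
  (* The branch for 0 records [e] itself and uses no new coordinate, so [c] is unchanged. *)
  + apply: leq_trans (IH0 c h (e :: Q) A0 z _ hc _ _ _ _) _; first by lia.
    * by rewrite /= Qc andbT; apply: small_pexp_leq se.
    * move=> i; rewrite inE => /andP[/zA[Qi xi +] ei]; rewrite eE ei => ti.
      by split => //=; rewrite ei.
    * move=> y /= /andP[ye Qy] yt; apply: yS => //.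
      by rewrite eE ye.
    * by move=> i j C; rewrite !inE => /andP[iA _] /andP[jA _]; exact: xC.
    * by apply: Bge => /=; lia.
  (* The value [1 / sqrt e] at [v] solves [e * v ^+ 2 = 1]. *)
  + pose z' i := set_coord v (Num.sqrt (pev e (z i))^-1) (z i).
    apply: leq_trans (IHp c.+1 h (w (-1) :: Q) Ap z' _ hc' (Qc' _) _ _ _) _; first by lia.
    * move=> i; rewrite inE => /andP[/zA[Qi xi +] ei].
      rewrite eE ei gt_eqF // => ti.
      rewrite /z' lsubmx_set_coord ?leq_addr // (map_pev_set_coord _ _ _ hc) //.
      rewrite /= -/(vanish _ _) (vanish_set_coord _ _ _ Qc) // Qi andbT.
      rewrite (pev_set_coord _ _ _ se) // set_coordE -expr2 sqr_sqrtr ?invr_ge0 ?ltW //.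
      by split=> //; rewrite divff ?subrr // gt_eqF.
    * move=> y /= /andP[/eqP ye Qy] yt; apply: yS => //.
      have yp : 0 < pev e y.
        rewrite ltNge; apply/negP => y0; have := sqr_ge0 (y ord0 v).
        by move: ye; rewrite -expr2; nra.
      by rewrite eE yp gt_eqF.
    * by move=> i j C; rewrite !inE => /andP[iA _] /andP[jA _]; exact: xC.
    * by apply: Bge => /=; lia.
  + pose z' i := set_coord v (Num.sqrt (- pev e (z i))^-1) (z i).
    apply: leq_trans (IHn c.+1 h (w 1 :: Q) An z' _ hc' (Qc' _) _ _ _) _; first by lia.
    * move=> i; rewrite inE => /andP[/zA[Qi xi +] ei].
      rewrite eE lt_eqF // ltNge ltW //= => ti.
      rewrite /z' lsubmx_set_coord ?leq_addr // (map_pev_set_coord _ _ _ hc) //.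
      rewrite /= -/(vanish _ _) (vanish_set_coord _ _ _ Qc) // Qi andbT.
      rewrite (pev_set_coord _ _ _ se) // set_coordE -expr2 sqr_sqrtr; last first.
        by rewrite invr_ge0 oppr_ge0 ltW.
      by split=> //; rewrite invrN mulrN divff ?addNr // lt_eqF.
    * move=> y /= /andP[/eqP ye Qy] yt; apply: yS => //.
      have yp : pev e y < 0.
        rewrite ltNge; apply/negP => y0; have := sqr_ge0 (y ord0 v).
        by move: ye; rewrite -expr2; nra.
      by rewrite eE lt_eqF // ltNge ltW.
    * by move=> i j C; rewrite !inE => /andP[iA _] /andP[jA _]; exact: xC.
    * by apply: Bge => /=; lia.
Qed.

(** One point is chosen in each component, and the induction starts at the root with no equations.
    For height [h >= 1] the spare factor 7 is absorbed by [7 ^ (3 * h).+1 <= 7 ^ (4 * h)]; a single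
    leaf is treated apart. *)
Lemma act_b0_bound N (S : set (RPt N)) (t : act N) b :
  act_tests t S -> b0 S b -> (b <= (3 * 7 ^ 4) ^ act_height t)%N.
Proof.
move=> [_ tS] [f [fI fC]].
have /choice[x xP] i : exists x, S x /\ f i = connected_component S x.
  by apply/fC; exists i.
have xC (i j : 'I_b) C : i \in [set: 'I_b]%SET -> j \in [set: 'I_b]%SET ->
    connected C -> C `<=` S -> C (x i) -> C (x j) -> i = j.
  move=> _ _ cC CS Ci Cj; apply: fI.
  rewrite (xP i).2 (xP j).2; apply: same_connected_component.
  by exists C.
case: t tS => [l|op a1 a2 t|a t0 tp tn] tS.
(* Two components would force the leaf to be YES, so [S] would be the whole space, where a segment
   joins the two chosen points. *)
- rewrite expn0 leqNgt; apply/negP => b1.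
  pose i0 := Ordinal (ltnW b1); pose i1 := Ordinal b1.
  have [C [cC C0 C1 _]] := segment_in_connected (x i0) (x i1).
  have lT : l by have /tS := (xP i0).1.
  suff : i0 = i1 by move/(congr1 val).
  by apply: (xC _ _ C); rewrite ?inE // => y _; apply/tS.
all: set T := (T in act_height T).
(* With [K] one more than the height, a coordinate is left for the slack variable at every leaf. *)
all: have := @act_components_bound N (act_height T).+1 S 'I_b x T 0 [::] [::]
    [set: 'I_b]%SET (fun i => row_mx (x i) 0).
all: rewrite cardsT card_ord => bb; apply: leq_trans (bb _ _ _ _ _ _) _ => //.
all: try by move=> i _; rewrite row_mxKl; split=> //; apply/tS; exact: (xP i).1.
all: try by move=> y _ /tS.
all: rewrite expnMn -expnM leq_mul // leq_exp2l //; rewrite /T /=; lia.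
Qed.

(** * The lower bound for the height *)

Theorem mainTheorem8 :
  exists c1 c2 : RR, 0 < c1 /\ 0 < c2 /\
  forall (N : nat) (S : set (RPt N)) (V : set (CPt N))
         (n : nat) (W : 'I_n -> set (CPt N)) (t : act N)
         (b dimV degV : nat),
    semialgebraic S ->
    real_alg_set V ->
    (forall i, nonsingular_real_variety (W i)) ->
    V = \bigcup_(i in setT) W i ->
    S `<=` [set x | V (cplx_pt x)] ->
    act_tests t S ->
    b0 S b -> zdim V dimV -> zdeg V degV ->
    (c1 * ln (b%:R : RR) - c2 * (dimV%:R : RR)) / (1 + ln (degV%:R : RR))
      <= ((act_height t)%:R : RR).
Proof.
pose M : RR := (3 * 7 ^ 4)%:R.
have M1 : 1 < M by rewrite /M ltr1n.
have lnM : 0 < ln M by rewrite ln_gt0.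
(* [b <= M ^ h] gives [ln b / ln M <= h]. The numerator is then at most [h], hence at most [h] times
   the denominator, which is at least 1. *)
exists (ln M)^-1, 1; split; first by rewrite invr_gt0.
split=> // N S V n W t b dimV degV _ _ _ _ _ tS bS _ _.
have bh := act_b0_bound tS bS.
have lnb : (ln M)^-1 * ln (b%:R : RR) <= (act_height t)%:R.
  rewrite mulrC ler_pdivrMr // mulr_natl -lnXn ?(lt_trans ltr01) //.
  (* For [b = 0] the convention [ln 0 = 0] applies; the same convention is used below for
     [degV = 0]. *)
  have [->|b0] := posnP b; first by rewrite ln0 // ln_ge0 // exprn_ege1 // ltW.
  rewrite ler_ln ?posrE ?ltr0n ?exprn_gt0 ?(lt_trans ltr01) //.
  by rewrite -natrX ler_nat.
have lnd : 0 <= ln (degV%:R : RR).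
  have [->|d0] := posnP degV; first by rewrite ln0.
  by rewrite ln_ge0 // ler1n.
rewrite ler_pdivrMr ?(lt_le_trans ltr01) ?lerDl //.
rewrite mul1r; apply: (@le_trans _ _ (act_height t)%:R).
  by rewrite lerBlDr (le_trans lnb) // lerDl.
by rewrite ler_peMr // lerDl.
Qed.
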